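(* The Realizability Algorithm is sound. That is, for every contract $(A,(G_I,G_T))$ over types $\mathsf{state}$ and $\mathsf{input}$: if the Realizability Algorithm run on the contract returns ''unrealizable'', then the contract is not realizable; and if it returns ''realizable'', then the contract is realizable.
   Context: Fix types (sets) $\mathsf{state}$ and $\mathsf{input}$; $s, s', s_j$ range over states and $i, i_j$ over inputs. No finiteness or decidability is assumed. A transition system is a pair $(I,T)$ of predicates $I$ on $\mathsf{state}$ (initial states) and $T$ on $\mathsf{state}\times\mathsf{input}\times\mathsf{state}$ (transitions; $T(s,i,s')$ means the system can move from $s$ to $s'$ on input $i$). A contract is a pair $(A,(G_I,G_T))$ where $A$ is a predicate on $\mathsf{state}\times\mathsf{input}$ (assumption), $G_I$ a predicate on $\mathsf{state}$ (initial guarantee), and $G_T$ a predicate on $\mathsf{state}\times\mathsf{input}\times\mathsf{state}$ (transitional guarantee). Given $(I,T)$ and $A$, the predicate $\mathsf{Reachable}_A$ on states is defined inductively (the least predicate) by $$\mathsf{Reachable}_A(s) = I(s) \lor \exists s_{p}, i.\ \mathsf{Reachable}_A(s_{p}) \land A(s_{p}, i) \land T(s_{p}, i, s).$$ A transition system $(I,T)$ is a realization of $(A,(G_I,G_T))$ when all of the following hold: 1. $\forall s.\ I(s) \Rightarrow G_I(s)$; 2. $\forall s,i,s'.\ \mathsf{Reachable}_A(s) \land A(s,i) \land T(s,i,s') \Rightarrow G_T(s,i,s')$; 3. $\exists s.\ I(s)$; 4. $\forall s,i.\ \mathsf{Reachable}_A(s) \land A(s,i) \Rightarrow \exists s'.\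 T(s,i,s')$. A contract is realizable if there exists a transition system (over the same types) which is a realization of it. Finite viability: $\mathsf{Viable}_0(s)$ holds for every $s$, and $\mathsf{Viable}_{n}(s)$ is the formula $$\forall i_1.\ A(s,i_1) \Rightarrow \exists s_1.\ G_T(s,i_1,s_1) \land \bigl(\forall i_2.\ A(s_1,i_2) \Rightarrow \exists s_2.\ G_T(s_1,i_2,s_2) \land \cdots \land (\forall i_n.\ A(s_{n-1},i_n) \Rightarrow \exists s_n.\ G_T(s_{n-1},i_n,s_n))\cdots\bigr),$$ i.e. $\mathsf{Viable}_{n+1}(s) = \forall i.\ A(s,i) \Rightarrow \exists s'.\ G_T(s,i,s') \land \mathsf{Viable}_n(s')$. One-step extension: $\mathsf{Extend}_n(s)$ is the statement that any valid path of length $n$ from $s$ can be extended in response to any valid input: $$\forall i_1,s_1,\ldots,i_n,s_n.\ \bigl(A(s,i_1)\land G_T(s,i_1,s_1)\land\cdots\land A(s_{n-1},i_n)\land G_T(s_{n-1},i_n,s_n)\bigr) \Rightarrow \forall i.\ A(s_n,i)\Rightarrow \exists s'.\ G_T(s_n,i,s'),$$ where for $n=0$ the hypothesis is empty and $s_0 = s$. $\mathsf{BaseCheck}(n)$ is the statement $\exists s.\ G_I(s) \land \mathsf{Viable}_n(s)$, and $\mathsf{ExtendCheck}(n)$ is the statement $\forall s.\ \mathsf{Extend}_n(s)$. Realizability Algorithm: for $n = 0, 1, 2, \ldots$ in order, do the following: if $\mathsf{BaseCheck}(n)$ is false, return ''unrealizable'' and stop; otherwise, if $\mathsf{ExtendCheck}(n)$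 is true, return ''realizable'' and stop; otherwise continue with $n+1$. (The checks are treated as answered according to their truth values; the algorithm may run forever, in which case it returns nothing.) Thus it returns ''unrealizable'' exactly when there is $n$ with $\neg\mathsf{BaseCheck}(n)$ and, for all $m<n$, $\mathsf{BaseCheck}(m)\land\neg\mathsf{ExtendCheck}(m)$; and it returns ''realizable'' exactly when there is $n$ with $\mathsf{BaseCheck}(n)\land\mathsf{ExtendCheck}(n)$ and, for all $m<n$, $\mathsf{BaseCheck}(m)\land\neg\mathsf{ExtendCheck}(m)$. *)

(* Defs.v *)
From Stdlib Require Import List Arith Lia.

Set Implicit Arguments.

Record transition_system (state input : Type) : Type := TransitionSystem {
  init : state -> Prop;
  trans : state -> input -> state -> Prop
}.

Record contract (state input : Type) : Type := Contract {
  assumption : state -> input -> Prop;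
  init_guarantee : state -> Prop;
  trans_guarantee : state -> input -> state -> Prop
}.

Inductive Reachable (state input : Type) (S : transition_system state input)
    (A : state -> input -> Prop) : state -> Prop :=
| Reachable_init s : init S s -> Reachable S A s
| Reachable_step sp i s :
    Reachable S A sp -> A sp i -> trans S sp i s -> Reachable S A s.

Definition realization (state input : Type) (S : transition_system state input)
    (C : contract state input) : Prop :=
  (forall s, init S s -> init_guarantee C s) /\
  (forall s i s', Reachable S (assumption C) s /\ assumption C s i /\ trans S s i s' ->
     trans_guarantee C s i s') /\
  (exists s, init S s) /\
  (forall s i, Reachable S (assumption C) s /\ assumption C s i ->
     exists s', trans S s i s').

Definition realizable (state input : Type) (C : contract state input) : Prop :=
  exists S : transition_system state input, realization S C.

Fixpoint Viable (state input : Type) (C : contract state input) (n : nat) (s : state)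
    : Prop :=
  match n with
  | 0 => True
  | S m => forall i, assumption C s i ->
      exists s', trans_guarantee C s i s' /\ Viable C m s'
  end.

(* A path from [s] is the list of pairs [(i_1, s_1), ..., (i_n, s_n)]; the start state
   [s] is not in the list, and the length of the list is the number of steps. *)
Fixpoint valid_path (state input : Type) (C : contract state input) (s : state)
    (p : list (input * state)) : Prop :=
  match p with
  | nil => True
  | (i, s1) :: p' =>
      assumption C s i /\ trans_guarantee C s i s1 /\ valid_path C s1 p'
  end.

(* The default value of [last] makes this [s] for the empty path. *)
Definition end_state (state input : Type) (s : state) (p : list (input * state)) : state :=
  last (map snd p) s.

Definition Extend (state input : Type) (C : contract state input) (n : nat) (s : state)
    : Prop :=
  forall p : list (input * state), length p = n -> valid_path C s p ->
  forall i, assumption C (end_state s p) i ->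
  exists s', trans_guarantee C (end_state s p) i s'.

Definition BaseCheck (state input : Type) (C : contract state input) (n : nat) : Prop :=
  exists s, init_guarantee C s /\ Viable C n s.

Definition ExtendCheck (state input : Type) (C : contract state input) (n : nat) : Prop :=
  forall s, Extend C n s.

Inductive answer : Set := Unrealizable | Realizable.

(* [run_from C n r]: the loop, entered with counter [n], terminates and returns [r].
   The checks are answered by their truth values; a diverging loop returns nothing. *)
Inductive run_from (state input : Type) (C : contract state input)
    : nat -> answer -> Prop :=
| run_unrealizable n : ~ BaseCheck C n -> run_from C n Unrealizable
| run_realizable n : BaseCheck C n -> ExtendCheck C n -> run_from C n Realizable
| run_continue n r :
    BaseCheck C n -> ~ ExtendCheck C n -> run_from C (S n) r -> run_from C n r.

Definition algorithm_returns (state input : Type) (C : contract state input) (r : answer)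
    : Prop :=
  run_from C 0 r.

Lemma algorithm_returnsE (state input : Type) (C : contract state input) (r : answer) :
  algorithm_returns C r <->
  exists n,
    match r with
    | Unrealizable => ~ BaseCheck C n
    | Realizable => BaseCheck C n /\ ExtendCheck C n
    end /\
    forall m, m < n -> BaseCheck C m /\ ~ ExtendCheck C m.
Proof.
unfold algorithm_returns; split.
- intro H.
  cut (exists n,
    match r with
    | Unrealizable => ~ BaseCheck C n
    | Realizable => BaseCheck C n /\ ExtendCheck C n
    end /\
    forall m, 0 <= m < n -> BaseCheck C m /\ ~ ExtendCheck C m).
  { intros [n [Hn Hm]]; exists n; split; [exact Hn|].
    intros m lt_mn; apply Hm; lia. }
  induction H as [n HB|n HB HE|n r HB HE _ [k [Hk Hm]]].
  + exists n; split; [assumption|intros; lia].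
  + exists n; split; [split; assumption|intros; lia].
  + exists k; split; [exact Hk|].
    intros m Hmk; destruct (Nat.eq_dec m n) as [->|ne]; [split; assumption|].
    apply Hm; lia.
- intros [n [Hn Hm]].
  assert (run : run_from C n r).
  { destruct r; [now constructor|destruct Hn; now constructor]. }
  clear Hn; induction n as [|n IH]; [exact run|].
  apply IH; [intros m lt_mn; apply Hm; lia|].
  destruct (Hm n (Nat.lt_succ_diag_r n)); now apply run_continue.
Qed.

(* Main.v *)
From Stdlib Require Import List.
Require Import Defs.

Set Implicit Arguments.

(** Every reachable state of a realization is viable to every depth, so a failing
    [BaseCheck] rules out any realization.  Conversely, if [ExtendCheck C n] holds, then
    viability to depth [n] improves to depth [S n], so from an [n]-viable state every
    valid input has an answer that is again [n]-viable: the system that starts and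
    stays in the [n]-viable states is a realization. *)

(** Induction on the depth: the successor that [T] provides is itself reachable. *)
Lemma realization_viable (state input : Type) (C : contract state input)
    (T : transition_system state input) :
  realization T C ->
  forall n s, Reachable T (assumption C) s -> Viable C n s.
Proof.
intros (_ & HG & _ & HT) n; induction n as [|n IH]; simpl; [easy|].
intros s Hs i Hi.
destruct (HT s i (conj Hs Hi)) as [s' Hs'].
exists s'; split; [now apply HG|].
apply IH; now apply Reachable_step with s i.
Qed.

Lemma realizable_BaseCheck (state input : Type) (C : contract state input) :
  realizable C -> forall n, BaseCheck C n.
Proof.
intros [T HT] n.
pose proof HT as (HI & _ & [s Hs] & _).
exists s; split; [now apply HI|].
apply realization_viable with T; [exact HT|now apply Reachable_init].
Qed.

Lemma end_state_cons (state input : Type) (s s' : state) (i : input)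
    (p : list (input * state)) :
  end_state s ((i, s') :: p) = end_state s' p.
Proof.
unfold end_state; simpl map.
revert s s'; induction (map snd p) as [|a l IH]; intros s s'; [reflexivity|].
(* The default is irrelevant on a nonempty list: both sides equal [last l a]. *)
change (last (a :: l) s = last (a :: l) s').
now rewrite (IH s), (IH s').
Qed.

(** Prefixing a path from [s'] with [(i, s')] keeps its end state. *)
Lemma Extend_cons (state input : Type) (C : contract state input) n s i s' :
  Extend C (S n) s -> assumption C s i -> trans_guarantee C s i s' ->
  Extend C n s'.
Proof.
intros HE Hi Hs' p Hlen Hp.
rewrite <- (end_state_cons s s' i p).
apply HE; simpl; auto.
Qed.

(** Viability answers the first [n] inputs by a valid path, and [Extend] answers one more at its
    end. *)
Lemma Viable_Extend (state input : Type) (C : contract state input) n s :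
  Viable C n s -> Extend C n s -> Viable C (S n) s.
Proof.
revert s; induction n as [|n IH]; intros s HV HE i Hi.
- destruct (HE nil eq_refl I i Hi) as [s' Hs'].
  now exists s'.
- destruct (HV i Hi) as (s' & Hs' & HV').
  exists s'; split; [exact Hs'|].
  apply IH; [exact HV'|now apply Extend_cons with s i].
Qed.

Lemma checks_realizable (state input : Type) (C : contract state input) n :
  BaseCheck C n -> ExtendCheck C n -> realizable C.
Proof.
intros [s0 Hs0] HE.
exists (TransitionSystem (fun s => init_guarantee C s /\ Viable C n s)
          (fun s i s' => trans_guarantee C s i s' /\ Viable C n s')).
split; [|split; [|split]]; simpl.
- now intros s [].
- now intros s i s' (_ & _ & []).
- now exists s0.
- intros s i [Hs Hi].
  (* Initial states and transition targets are [n]-viable by construction. *)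
  assert (HV : Viable C n s) by now destruct Hs as [s []|sp j s _ _ []].
  (* [Viable C (S n) s] at input [i] unfolds to exactly this goal. *)
  exact (Viable_Extend HV (HE s) i Hi).
Qed.

Theorem corollary1 (state input : Type) (C : contract state input) :
  (algorithm_returns C Unrealizable -> ~ realizable C) /\
  (algorithm_returns C Realizable -> realizable C).
Proof.
split; intro H; apply algorithm_returnsE in H; destruct H as (n & Hn & _).
- intro HC; apply Hn, realizable_BaseCheck, HC.
- now apply checks_realizable with n.
Qed.
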